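(* Let $p>2$ be a prime, and let $$\mathcal{G}(p)=\langle x,y : x^{p^2}=1,\ y^{p^2}=1,\ [x,y]=x^p\rangle .$$ For $d\in\mathbf{F}_p^{*}$ and $s\in\mathbf{F}_p$ let $\theta_{d,s}$ be the permutation of the set $\mathcal{G}(p)$ defined in the context, considered modulo $\operatorname{Hol}(\mathcal{G}(p))$, that is, as an element of $T(\mathcal{G}(p))$. Then for all $d,e\in\mathbf{F}_p^{*}$ and $s,u\in\mathbf{F}_p$, $$\theta_{d,s}\,\theta_{e,u}\equiv\theta_{de,\;s e'+u}\pmod{\operatorname{Hol}(\mathcal{G}(p))},$$ where $e'$ is the inverse of $e$ in $\mathbf{F}_p^{*}$. Therefore $$T(\mathcal{G}(p))=\{\theta_{d,s} : d\in\mathbf{F}_p^{*},\ s\in\mathbf{F}_p\},$$ a group of order $p(p-1)$, is isomorphic to $\operatorname{AGL}(1,p)$, that is, to the holomorph of a group of order $p$.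
   Context: For a group $G$, $S(G)$ is the group of permutations of the set $G$, under left-to-right composition; permutations and automorphisms are written as exponents, $g\mapsto g^{\alpha}$. Let $\rho:G\to S(G)$, $\rho(g):h\mapsto hg$, be the right regular representation. Put $\operatorname{Hol}(G)=N_{S(G)}(\rho(G))=\operatorname{Aut}(G)\rho(G)$, $\operatorname{NHol}(G)=N_{S(G)}(\operatorname{Hol}(G))$ and $T(G)=\operatorname{NHol}(G)/\operatorname{Hol}(G)$. Commutators are $[a,b]=a^{-1}b^{-1}ab$. Let $G=\mathcal{G}(p)$; it has order $p^4$ and nilpotence class two. For $s,t\in\mathbf{F}_p$ let $\gamma_{s,t}:G\to\operatorname{Aut}(G)$ be the group homomorphism (with abelian image) such that $\gamma_{s,t}(x)$ is the automorphism $x\mapsto x$, $y\mapsto x^{ps}y$, and $\gamma_{s,t}(y)$ is the automorphism $x\mapsto x^{1+pt}$, $y\mapsto y^{1+p(s+t)}$. Given $d\in\mathbf{F}_p^{*}$ with inverse $d'$ and $s\in\mathbf{F}_p$, put $t=d'+s-1$ and let $\circ$ be the group operation on the set $G$ given by $g\circ h=g^{\gamma_{s,t}(h)}h$. Then $\theta_{d,s}$ is the group isomorphism $G\to(G,\circ)$ determined by $x\mapsto x$, $y\mapsto y^{d}$ (where $d$ is replaced by an integer representative; the class of $\theta_{d,s}$ in $T(G)$ does not depend on the representative). The symbol $\equiv$ denotes equality of classes in $T(G)$, and in the displayed description of $T(\mathcal{G}(p))$ the $\theta_{d,s}$ stand for their classes. *)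

(* Defs.v *)
From mathcomp Require Import all_boot all_order all_algebra all_fingroup all_solvable.
Set Implicit Arguments.
Unset Strict Implicit.
Unset Printing Implicit Defensive.
Import GRing.Theory.
Local Open Scope group_scope.

(* A finite group G is the whole of a finGroupType gT, so that S(G) is        *)
(* {perm gT}, whose product is composition from left to right. The action 'R  *)
(* is h, g |-> h * g, hence actperm 'R is the representation rho.             *)

Section Holomorph.
Variable gT : finGroupType.

Definition Hol : {group {perm gT}} := 'N(actperm 'R @* [set: gT])%G.

Definition NHol : {group {perm gT}} := 'N(Hol)%G.

Definition T : {group coset_of Hol} := (NHol / Hol)%G.

End Holomorph.

Arguments Hol gT : clear implicits.
Arguments NHol gT : clear implicits.
Arguments T gT : clear implicits.

(* [set: gT] is the group presented by                                        *)
(* < x, y : x^(p^2) = 1, y^(p^2) = 1, [x, y] = x^p >, with x and y the images *)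
(* of the generators. The first clause fixes the isomorphism type of the      *)
(* group; as the group is finite, any pair of generators that satisfies the   *)
(* relations is then the image of the presentation's generators under an      *)
(* isomorphism.                                                               *)
Definition presents (p : nat) (gT : finGroupType) (x y : gT) : Prop :=
  [/\ [set: gT] \isog
        Grp (x : y : x ^+ (p ^ 2), y ^+ (p ^ 2), [~ x, y] = x ^+ p),
      <<[set x; y]>> = [set: gT],
      x ^+ (p ^ 2) = 1,
      y ^+ (p ^ 2) = 1
    & [~ x, y] = x ^+ p].

Section Theta.
Variables (p : nat) (gT : finGroupType) (x y : gT).

(* Elements of 'F_p in exponents are coerced to their representatives in      *)
(* {0, ..., p - 1}; since the exponent is multiplied by p and x, y have order *)
(* p^2, the choice of the representative does not matter.                     *)
Definition is_gamma (s t : 'F_p)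
    (gamma : {morphism [set: gT] >-> {perm gT}}) : Prop :=
  [/\ gamma @* [set: gT] \subset Aut [set: gT],
      gamma x x = x /\ gamma x y = x ^+ (p * s)%N * y,
      gamma y x = x ^+ (1 + p * t)%N
    & gamma y y = y ^+ (1 + p * (s + t)%R)%N].

Definition circ (gamma : gT -> {perm gT}) (g h : gT) : gT := gamma h g * h.

(* th is theta_{d,s}, computed with the representative n of d. A permutation  *)
(* satisfying the third clause transports the group structure of gT to circ.  *)
Definition is_theta_rep (n : nat) (d s : 'F_p) (th : {perm gT}) : Prop :=
  exists2 gamma : {morphism [set: gT] >-> {perm gT}},
    is_gamma s (d^-1 + s - 1)%R gamma
  & [/\ n%:R%R = d,
        {morph th : g h / g * h >-> circ gamma g h},
        th x = x
      & th y = y ^+ n].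

Definition is_theta (d s : 'F_p) (th : {perm gT}) : Prop :=
  exists n : nat, is_theta_rep n d s th.

End Theta.

Section AffineGroup.
Variable p : nat.

Definition AGL1_set : {set {perm 'F_p}} :=
  [set f : {perm 'F_p} | [exists d : 'F_p, exists s : 'F_p,
     (d != 0%R) && [forall a, f a == (d * a + s)%R]]].

Lemma AGL1_group_set : group_set AGL1_set.
Proof.
apply/group_setP; split.
  rewrite inE; apply/existsP; exists 1%R; apply/existsP; exists 0%R.
  by rewrite oner_neq0; apply/forallP => a; rewrite perm1 mul1r addr0.
move=> f g; rewrite !inE.
move=> /existsP[d /existsP[s /andP[d0 /forallP fE]]].
move=> /existsP[e /existsP[u /andP[e0 /forallP gE]]].
apply/existsP; exists (e * d)%R; apply/existsP; exists (e * s + u)%R.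
rewrite mulf_neq0 //; apply/forallP => a.
by rewrite permM (eqP (fE a)) (eqP (gE _)) mulrDr mulrA addrA.
Qed.

Definition AGL1 : {group {perm 'F_p}} := Group AGL1_group_set.

End AffineGroup.

(* Main.v *)
Require Import Defs.
From mathcomp Require Import all_boot all_order all_algebra all_fingroup all_solvable.
From mathcomp Require Import finfield ring.
Set Implicit Arguments.
Unset Strict Implicit.
Unset Printing Implicit Defensive.
Local Open Scope group_scope.
Import GRing.Theory FinRing.Theory.

(** A permutation of a group G normalizes the right translations exactly when
it is affine, and NHol(G) consists of the permutations that transport the law
of G to a law circle with the same affine maps. If such a permutation fixes
1, the law can be written g circle h = g^(gamma h) h with gamma h in Aut(G);
having the same affine maps means that gamma is equivariant under Aut(G) and
is an antihomomorphism G -> Aut(G).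

For the group of the presentation everything is linear algebra over F_p. The
quotient V = G/Z(G) and the centre are planes with coordinates along x and y,
and the p-th power map identifies them ([expg_p]), so that an automorphism
acts on both by one matrix. Preserving [x, y] = x^p forces this matrix to be
triangular with second eigenvalue 1 ([aut_coords]).

Every pair (s, t) defines a bilinear map V x V -> Z(G), [pairing], invariant
under Aut(G), and a law g h pairing(g, h) whose right translations form a
normal subgroup of the holomorph. An isomorphism from G to this law, called
[twisted] below, normalizes Hol(G) ([twisted_NHol]); one exists, of the form
x |-> x, y |-> y^d, when d (1 + t - s) = 1, by the presentation of G
([exists_twisted]). For 1 + t - s = 0 the law is commutative.

Conversely, let gamma come from an element of NHol(G). Equivariance under the
two automorphisms x |-> 1/x and y |-> x y forces gamma h to act trivially on
V, so gamma is a bilinear map from V to the centre, and then forces that map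
to be a pairing ([NHol_twisted]). Two twisted maps with the same parameters
differ by an automorphism, and the class of a twisted map determines its
parameters. So T(G) is in bijection with the pairs (d, s) where d is nonzero,
and composition of twisted maps ([twisted_comp]) gives the product of
classes. This is the product of the affine maps a |-> a / d + s of F_p, and
these affine maps form the holomorph of the additive group of F_p. *)

(** * Morphisms between finite groups as plain functions *)

Section GeneratedGroups.
Variables (gT : finGroupType) (x y : gT).
Hypothesis genG : <<[set x; y]>> = [set: gT].

Lemma gen2_ind (Q : gT -> Prop) :
  Q x -> Q y -> (forall g h, Q g -> Q h -> Q (g * h)) -> forall g, Q g.
Proof.
move=> Qx Qy QM g.
have Q1 : Q 1.
  have Qxn n : Q (x ^+ n.+1) by elim: n => // n IHn; rewrite expgS; apply: QM.
  by rewrite -(expg_order x) -(prednK (order_gt0 x)).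
have: g \in <<[set x; y]>> by rewrite genG inE.
case/gen_prodgP => n [c cA ->]; elim/big_ind: _ => // i _.
by have:= cA i; rewrite !inE => /orP[] /eqP->.
Qed.

Lemma eq_morph_gen (rT : finGroupType) (f1 f2 : gT -> rT) :
  {morph f1 : g h / g * h} -> {morph f2 : g h / g * h} ->
  f1 x = f2 x -> f1 y = f2 y -> f1 =1 f2.
Proof.
by move=> f1M f2M ex ey; apply: gen2_ind => // g h eg eh; rewrite f1M f2M eg eh.
Qed.

End GeneratedGroups.

Section Morph.
Variables (gT rT : finGroupType) (f : gT -> rT).
Hypothesis fM : {morph f : g h / g * h}.
Let fm : {morphism [set: gT] >-> rT} := Morphism (in2W fM).

Lemma morphfun1 : f 1 = 1.
Proof. exact: (morph1 fm). Qed.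

Lemma morphfunV : {morph f : g / g^-1}.
Proof. by move=> g; apply: (morphV fm); rewrite inE. Qed.

Lemma morphfunX n : {morph f : g / g ^+ n}.
Proof. by move=> g; apply: (morphX fm); rewrite inE. Qed.

Lemma morphfun_inj : (forall g, f g = 1 -> g = 1) -> injective f.
Proof.
move=> ker1 g h e; apply/eqP; rewrite eq_mulgV1; apply/eqP/ker1.
by rewrite fM morphfunV e mulgV.
Qed.
End Morph.

(** * The holomorph as a group of affine maps *)

Section Holomorph.
Variable gT : finGroupType.
Implicit Types (f a : {perm gT}) (g h : gT).

Lemma rregE h g : actperm 'R h g = g * h.
Proof. exact: actpermE. Qed.

(** A permutation normalizes the right translations exactly when it is
affine, that is, an automorphism followed by a translation. The pointwise
form avoids a choice of the two factors. *)
Lemma HolP f :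
  reflect (forall g h, f (g * h) = f g * (f 1)^-1 * f h) (f \in Hol gT).
Proof.
apply: (iffP idP) => [/normP Nf g h | fE].
  have: actperm 'R h ^ f \in (actperm 'R @* [set: gT]) :^ f.
    by rewrite memJ_conjg mem_morphim ?inE.
  rewrite Nf => /morphimP[k _ _ /permP Ek].
  have {}Ek g' : f (g' * h) = f g' * k.
    by have:= Ek (f g'); rewrite permJ !rregE.
  by have := Ek 1; rewrite mul1g => ->; rewrite Ek mulgA mulgKV.
rewrite inE; apply/subsetP => _ /imsetP[_ /morphimP[h _ _ ->] ->].
suff ->: actperm 'R h ^ f = actperm 'R ((f 1)^-1 * f h).
  by rewrite mem_morphim ?inE.
by apply/permP => g; rewrite -[g](permKV f) permJ !rregE fE mulgA.
Qed.

Lemma AutTP a : reflect {morph a : g h / g * h} (a \in Aut [set: gT]).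
Proof.
rewrite inE; apply: (iffP andP) => [[_ /morphicP aM] g h | aM].
  by apply: aM; rewrite inE.
split; first by apply/subsetP=> g; rewrite inE.
by apply/morphicP => g h _ _; apply: aM.
Qed.

Lemma rreg_Hol h : actperm 'R h \in Hol gT.
Proof. by apply/HolP => g k; rewrite !rregE mul1g mulgK mulgA. Qed.

Lemma morph_Hol a : {morph a : g h / g * h} -> a \in Hol gT.
Proof.
by move=> aM; apply/HolP => g k; rewrite aM morphfun1 // invg1 mulg1.
Qed.

Lemma Hol_fix1 a : a \in Hol gT -> a 1 = 1 -> {morph a : g h / g * h}.
Proof. by move/HolP => aE a1 g h; rewrite aE a1 invg1 mulg1. Qed.

(** Hol = Aut rho: an affine map is an automorphism followed by the
translation by its value at 1. *)
Lemma Hol_decomp f : f \in Hol gT ->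
  exists2 b : {perm gT}, {morph b : g h / g * h} & f = b * actperm 'R (f 1).
Proof.
move=> Hf; exists (f * (actperm 'R (f 1))^-1); last by rewrite mulgKV.
apply: Hol_fix1; first by rewrite groupM ?groupV ?rreg_Hol.
by apply: (@perm_inj _ (actperm 'R (f 1))); rewrite permM permKV rregE mul1g.
Qed.

Lemma Hol_sub_NHol : Hol gT \subset NHol gT. Proof. exact: normG. Qed.

End Holomorph.

(** * The universal property of the presentation *)

Section Presented.
Variables (p : nat) (gT : finGroupType) (x y : gT).
Hypothesis pres : presents p x y.

(** In rT the pair (u, v) satisfies the relations, hence so does ((x, u), (y,
v)) in gT * rT. The subgroup K generated by the latter pair is therefore a
quotient of gT, and it projects onto gT because x and y generate. So the
projection K -> gT is bijective, and K is the graph of the required morphism.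
*)
Lemma presents_morph (rT : finGroupType) (u v : rT) :
    u ^+ (p ^ 2) = 1 -> v ^+ (p ^ 2) = 1 -> [~ u, v] = u ^+ p ->
  exists f : gT -> rT, [/\ {morph f : g h / g * h}, f x = u & f y = v].
Proof.
case: pres => isoG genG xp yp xy up vp uv.
pose a : gT * rT := (x, u); pose b : gT * rT := (y, v).
pose K : {group gT * rT} := <<[set a; b]>>%G.
have pX k l n : (k, l) ^+ n = (k ^+ n, l ^+ n) :> gT * rT.
  by elim: n => // n IHn; rewrite !expgS IHn.
have homK : K \homg [set: gT].
  rewrite isoG; apply/existsP; exists (a, b); rewrite /= !xpair_eqE.
  by rewrite !pX xp up yp vp -xy -uv joing_idl joing_idr !eqxx.
have Ka : a \in K by rewrite mem_gen // !inE eqxx.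
have Kb : b \in K by rewrite mem_gen // !inE eqxx orbT.
have fstK : [morphism of (@fst gT rT)] @* K = [set: gT].
  apply/eqP; rewrite eqEsubset subsetT -genG gen_subG.
  apply/subsetP => g; rewrite !inE => /orP[] /eqP->.
    by apply/morphimP; exists a; rewrite ?inE.
  by apply/morphimP; exists b; rewrite ?inE.
have injK : {in K &, injective (@fst gT rT)}.
  apply/imset_injP; rewrite -morphimEsub ?subsetT //.
  by rewrite eqn_leq leq_morphim fstK leq_homg.
(* K is now the graph of a function, which is extracted by choice. *)
have sect g : exists v, (g, v) \in K.
  have: g \in [morphism of (@fst gT rT)] @* K by rewrite fstK inE.
  by case/morphimP => -[g1 w] _ Kgw ->; exists w.
exists (fun g => xchoose (sect g)); split.
- move=> g h; have Kgh: (g * h, xchoose (sect g) * xchoose (sect h)) \in K.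
    exact: (groupM (xchooseP (sect g)) (xchooseP (sect h))).
  by have [] := injK _ _ (xchooseP (sect (g * h))) Kgh erefl.
- by have [] := injK _ _ (xchooseP (sect x)) Ka erefl.
by have [] := injK _ _ (xchooseP (sect y)) Kb erefl.
Qed.

End Presented.

(** * Structure of the group of order p^4 *)

Section FpExponents.
Variables (p : nat) (gT : finGroupType) (c : gT).
Hypotheses (p_pr : prime p) (cp : c ^+ p = 1).

Lemma expg_Fp_nat n : c ^+ (n%:R%R : 'F_p) = c ^+ n.
Proof. by rewrite val_Fp_nat // expg_mod. Qed.

Lemma expg_FpD (a b : 'F_p) : c ^+ (a + b)%R = c ^+ a * c ^+ b.
Proof.
by rewrite -expgD -[a in LHS]natr_Zp -[b in LHS]natr_Zp -natrD expg_Fp_nat.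
Qed.

Lemma expg_Fp_inj (a : 'F_p) : c != 1 -> c ^+ a = 1 -> a = 0%R.
Proof.
move=> c1 ca1; have oc : #[c] = p by apply: nt_prime_order.
apply/eqP; rewrite -[a]natr_Zp -val_eqE /= val_Fp_nat //.
by move/eqP: ca1; rewrite -order_dvdn oc.
Qed.
End FpExponents.

Section Structure.
Variables (p : nat) (gT : finGroupType) (x y : gT).
Hypotheses (p_pr : prime p) (p_gt2 : (2 < p)%N) (pres : presents p x y).

Let genG : <<[set x; y]>> = [set: gT]. Proof. by case: pres. Qed.
Let xpp : x ^+ (p ^ 2) = 1. Proof. by case: pres. Qed.
Let ypp : y ^+ (p ^ 2) = 1. Proof. by case: pres. Qed.
Let xyp : [~ x, y] = x ^+ p. Proof. by case: pres. Qed.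
Let ind2 := gen2_ind genG.

(** The conjugate of x by y is x^(1 + p), so that of x^p is x^(p + p^2) =
x^p. *)
Lemma comm_xp g : commute g (x ^+ p).
Proof.
elim/ind2: g => [||g h cg ch]; first exact: commuteX.
- apply: commute_sym; apply/commgP/conjg_fixP.
  rewrite conjXg conjg_mulR xyp -expgS -expgM mulSn expgD mulnn xpp.
  by rewrite mulg1.
- by apply: commute_sym; apply: commuteM; apply: commute_sym.
Qed.

Lemma comm_yp g : commute g (y ^+ p).
Proof.
elim/ind2: g => [||g h cg ch]; last first.
- by apply: commute_sym; apply: commuteM; apply: commute_sym.
- exact: commuteX.
apply/commgP; rewrite commgX xyp; last exact: comm_xp.
by rewrite -expgM mulnn xpp.
Qed.

(** The elements of the centre, written additively. The body is locked
because otherwise rewriting with a product pattern would look inside it. *)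
Definition cen (u v : 'F_p) : gT := locked ((x ^+ p) ^+ u * (y ^+ p) ^+ v).

Lemma cenE u v : cen u v = (x ^+ p) ^+ u * (y ^+ p) ^+ v.
Proof. by rewrite /cen -lock. Qed.

Let xp_p : (x ^+ p) ^+ p = 1. Proof. by rewrite -expgM mulnn. Qed.
Let yp_p : (y ^+ p) ^+ p = 1. Proof. by rewrite -expgM mulnn. Qed.

Lemma cenC u v g : cen u v * g = g * cen u v.
Proof.
rewrite cenE; apply: commute_sym; apply: commuteM; apply: commuteX.
  exact: comm_xp.
exact: comm_yp.
Qed.

Lemma cenJ u v g : cen u v ^ g = cen u v.
Proof. by rewrite conjgE cenC mulKg. Qed.

Lemma cenD u v u' v' : cen u v * cen u' v' = cen (u + u')%R (v + v')%R.
Proof.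
rewrite !cenE !expg_FpD // !mulgA; congr (_ * _).
rewrite -!mulgA; congr (_ * _).
exact/commuteX/commute_sym/commuteX/comm_yp.
Qed.

Lemma cen0 : cen 0%R 0%R = 1. Proof. by rewrite !cenE !expg0 mulg1. Qed.

Lemma cenV u v : (cen u v)^-1 = cen (- u)%R (- v)%R.
Proof. by apply/eqP; rewrite eq_invg_mul cenD !addrN cen0. Qed.

Lemma cenX u v n : cen u v ^+ n = cen (u *+ n)%R (v *+ n)%R.
Proof.
by elim: n => [|n IHn]; rewrite ?cen0 // expgS IHn cenD !mulrS.
Qed.

Lemma cen_nat0 n : cen n%:R%R 0%R = x ^+ (p * n).
Proof. by rewrite !cenE expg_Fp_nat // mulg1 expgM. Qed.

Lemma cen_0nat n : cen 0%R n%:R%R = y ^+ (p * n).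
Proof. by rewrite !cenE expg_Fp_nat // mul1g expgM. Qed.

Lemma expg_xp (u : 'F_p) : x ^+ (p * u) = cen u 0%R.
Proof. by rewrite -cen_nat0 natr_Zp. Qed.

Lemma expg_yp (u : 'F_p) : y ^+ (p * u) = cen 0%R u.
Proof. by rewrite -cen_0nat natr_Zp. Qed.

Lemma cen10 : x ^+ p = cen 1%R 0%R.
Proof. by rewrite -[1%R]/(1%:R)%R cen_nat0 muln1. Qed.

Lemma cen01 : y ^+ p = cen 0%R 1%R.
Proof. by rewrite -[1%R]/(1%:R)%R cen_0nat muln1. Qed.

(** The additive group F_p is killed by p and commutative, so the relations
impose nothing on the images of x and y. The characters ex and ey obtained
from (1, 0) and (0, 1) are the coordinates on the quotient of the group by
its centre. *)
Lemma exists_char (a b : 'F_p) : exists f : gT -> 'F_p,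
  [/\ forall g h, f (g * h) = (f g + f h)%R, f x = a & f y = b].
Proof.
have e1 (c : 'F_p) : c ^+ (p ^ 2) = 1.
  by rewrite zmodXgE -mulr_natr natrX pchar_Fp_0 // expr0n mulr0.
have [//|f [fM fx fy]] := presents_morph pres (e1 a) (e1 b).
  rewrite zmodXgE -mulr_natr pchar_Fp_0 // mulr0.
  by apply/eqP/commgP; apply: zmod_mulgC.
by exists f.
Qed.

Variables ex ey : gT -> 'F_p.
Hypothesis exM : forall g h, ex (g * h) = (ex g + ex h)%R.
Hypothesis eyM : forall g h, ey (g * h) = (ey g + ey h)%R.
Hypotheses (ex_x : ex x = 1%R) (ex_y : ex y = 0%R).
Hypotheses (ey_x : ey x = 0%R) (ey_y : ey y = 1%R).

Section Add.
Variable e : gT -> 'F_p.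
Hypothesis eM : forall g h, e (g * h) = (e g + e h)%R.
Lemma char1 : e 1 = 0%R. Proof. exact: (@morphfun1 gT 'F_p). Qed.
Lemma charX g n : e (g ^+ n) = (e g *+ n)%R.
Proof. exact: (@morphfunX gT 'F_p e eM n g). Qed.
Lemma charV g : e (g^-1) = (- e g)%R.
Proof. exact: (@morphfunV gT 'F_p e eM g). Qed.
Lemma char_cen u v : e (cen u v) = 0%R.
Proof.
have np (a : 'F_p) : (a *+ p = 0)%R by rewrite -mulr_natr pchar_Fp_0 // mulr0.
by rewrite cenE eM !charX !np !mul0rn addr0.
Qed.
Lemma char_basis g : e g = (e x * ex g + e y * ey g)%R.
Proof.
elim/ind2: g => [||g h eg eh]; rewrite ?ex_x ?ex_y ?ey_x ?ey_y; try ring.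
by rewrite eM exM eyM eg eh; ring.
Qed.
End Add.

(** Commutators lie in the central subgroup generated by x^p, so the
commutator map is bilinear; on the generators it takes the value x^p. *)
Lemma commE g h : [~ g, h] = cen (ex g * ey h - ey g * ex h)%R 0%R.
Proof.
have cenR g1 g2 h1 : [~ g1, h1] = cen (ex g1 * ey h1 - ey g1 * ex h1)%R 0%R ->
    [~ g2, h1] = cen (ex g2 * ey h1 - ey g2 * ex h1)%R 0%R ->
    [~ g1 * g2, h1] =
      cen (ex (g1 * g2)%g * ey h1 - ey (g1 * g2)%g * ex h1)%R 0%R.
  move=> e1 e2; rewrite commMgJ e1 e2 cenJ cenD exM eyM.
  by congr cen; ring.
have comm_x g1 : [~ g1, x] = cen (ex g1 * ey x - ey g1 * ex x)%R 0%R.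
  elim/ind2: g1 => [||g1 g2 e1 e2]; rewrite ?cenR // ?commgg.
    by rewrite -cen0; congr cen; rewrite ex_x ey_x; ring.
  rewrite -invg_comm xyp ex_x ey_x ex_y ey_y cen10 cenV.
  by congr cen; ring.
have comm_y g1 : [~ g1, y] = cen (ex g1 * ey y - ey g1 * ex y)%R 0%R.
  elim/ind2: g1 => [||g1 g2 e1 e2]; rewrite ?cenR // ?commgg.
    rewrite xyp ex_x ey_x ex_y ey_y cen10.
    by congr cen; ring.
  by rewrite -cen0; congr cen; rewrite ex_y ey_y; ring.
elim/ind2: h => [||h1 h2 e1 e2] //.
rewrite commgMJ e1 e2 cenJ cenD exM eyM.
by congr cen; ring.
Qed.

Lemma expMg_cen g h n :
  (g * h) ^+ n =
    g ^+ n * h ^+ n * cen ((ey g * ex h - ex g * ey h) *+ 'C(n, 2))%R 0%R.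
Proof.
rewrite expMg_Rmul commE; try by rewrite /commute cenC.
by rewrite cenX mul0rn; congr (_ * cen (_ *+ _)%R _); ring.
Qed.

Let mulrn_bin2p (a : 'F_p) : (a *+ 'C(p, 2) = 0)%R.
Proof.
rewrite -mulr_natr; suff ->: 'C(p, 2)%:R%R = 0%R :> 'F_p by rewrite mulr0.
apply/val_inj; rewrite /= val_Fp_nat //; apply/eqP.
by apply: prime_dvd_bin; rewrite // p_gt2.
Qed.

(** As p is odd, p divides the binomial coefficient of p over 2, so in class
two the p-th power map is multiplicative. It identifies the quotient by the
centre with the centre. Hence any map that respects p-th powers acts on the
centre as it acts on this quotient. *)
Lemma expg_p g : g ^+ p = cen (ex g) (ey g).
Proof.
elim/ind2: g => [||g h eg eh].
- by rewrite ex_x ey_x cen10.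
- by rewrite ex_y ey_y cen01.
rewrite expMg_cen eg eh mulrn_bin2p cen0 mulg1 cenD.
by rewrite exM eyM.
Qed.

Lemma expg_pp (g : gT) : g ^+ (p ^ 2) = 1.
Proof. by rewrite -mulnn expgM expg_p expg_p !char_cen // cen0. Qed.

Lemma normal_form g : exists a b : nat, g = x ^+ a * y ^+ b.
Proof.
elim/ind2: g => [||_ _ [a [b ->]] [c [d ->]]].
- by exists 1%N, 0%N; rewrite mulg1.
- by exists 0%N, 1%N; rewrite mul1g.
have [w ew]: exists w : 'F_p, [~ y ^+ b, x ^+ c] = cen w 0%R.
  by rewrite commE; eexists.
rewrite -expg_xp in ew.
exists (a + c + p * w)%N, (b + d)%N.
rewrite !expgD !mulgA; congr (_ * _); rewrite -!mulgA; congr (_ * _).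
rewrite mulgA (commgC (y ^+ b)) ew -!mulgA; congr (_ * _).
by rewrite expgM; apply/commuteX/comm_xp.
Qed.

(** In the normal form x^a y^b the coordinates are the classes of a and b
modulo p. *)
Lemma cen_ker g : ex g = 0%R -> ey g = 0%R -> exists u v, g = cen u v.
Proof.
have [a [b ->]] := normal_form g.
have dv n : n%:R%R = 0%R :> 'F_p -> exists m, n = (p * m)%N.
  move/(congr1 val); rewrite /= val_Fp_nat // => /eqP; rewrite -/(dvdn p n).
  by case/dvdnP => m ->; exists m; rewrite mulnC.
rewrite exM eyM !charX // ex_x ex_y ey_x ey_y !mul0rn addr0 add0r.
move=> /dv[a' ->] /dv[b' ->]; exists a'%:R%R, b'%:R%R.
by rewrite -cen_nat0 -cen_0nat cenD addr0 add0r.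
Qed.

(** The modular group of order p^3 is a quotient of the presented group in
which x keeps the order p^2. *)
Let xp_neq1 : x ^+ p != 1.
Proof.
have [[u v] [_ _ ou _] [ov uv]] :=
  @generators_modular_group _ _ p_pr (ltnSn 2) _ _
    (isog_refl [set: 'Mod_(p ^ 3)]).
have [|||f [fM fx fy]] := presents_morph pres (u := u) (v := v).
- by rewrite -ou expg_order.
- have vp : v ^+ p = 1 by rewrite -[RHS](expg_order v) ov.
  by rewrite -mulnn expgM vp expg1n.
- by rewrite commgEl uv /= expn1 expgS mulKg.
apply/eqP => /(congr1 f); rewrite morphfunX // morphfun1 // fx => /eqP.
rewrite -order_dvdn ou /= -mulnn => /(dvdn_leq (prime_gt0 p_pr)).
by rewrite leqNgt ltn_Pmull ?prime_gt1 ?prime_gt0.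
Qed.

(** The exponent of y is detected by the morphism to Z/p^2 that sends x to 0
and y to 1; that of x then by the order of x^p. *)
Lemma cen_inj u v : cen u v = 1 -> u = 0%R /\ v = 0%R.
Proof.
move=> uv1; suff v0 : v = 0%R.
  split=> //; apply: (@expg_Fp_inj p gT (x ^+ p)) => //.
  by move: uv1; rewrite !cenE v0 mulg1.
have q_gt1 : (1 < p ^ 2)%N by rewrite -(expn0 p) ltn_exp2l ?prime_gt1.
have Zq0 n : (n%:R%R = 0%R :> 'Z_(p ^ 2)) <-> (p ^ 2 %| n)%N.
  split=> [/(congr1 val) | dvn]; first by rewrite /= val_Zp_nat // => /eqP.
  by apply/val_inj; rewrite /= val_Zp_nat //; apply/eqP.
have [|||f [fM fx fy]] :=
  presents_morph pres (rT:='Z_(p ^ 2)) (u := 0%R) (v := 1%R).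
- by rewrite zmodXgE mul0rn.
- by rewrite zmodXgE; apply/Zq0.
- by rewrite zmodXgE mul0rn; apply/eqP/commgP/zmod_mulgC.
move/(congr1 f): uv1; rewrite cenE (morphfun1 fM) fM !(morphfunX fM) fx fy.
rewrite !zmodXgE zmodMgE !mul0rn add0r -mulrnA => /Zq0.
rewrite -mulnn dvdn_pmul2l ?prime_gt0 // => pv.
by rewrite -[v]natr_Zp; apply/val_inj; rewrite /= val_Fp_nat //; apply/eqP.
Qed.

Lemma cen_inj2 u v u' v' : cen u v = cen u' v' -> u = u' /\ v = v'.
Proof.
move/(congr1 (mulg (cen u' v')^-1)); rewrite mulVg cenV cenD => /cen_inj[].
by rewrite !(addrC (- _)%R) => /subr0_eq -> /subr0_eq ->.
Qed.

Lemma nonabelian : [~ x, y] <> 1.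
Proof. by rewrite xyp; apply/eqP. Qed.

(** * Bilinear maps into the centre and the operations they define *)

Lemma cen_expg_p u v : cen u v = (x ^+ u * y ^+ v) ^+ p.
Proof.
rewrite expg_p exM eyM !(charX exM) !(charX eyM) ex_x ex_y ey_x ey_y.
by rewrite !mul0rn addr0 add0r !natr_Zp.
Qed.

Let char_cenE := (char_cen exM, char_cen eyM, exM, eyM).

(** The bilinear map with matrix given by (x, y) |-> t x, (y, x) |-> s x, (y,
y) |-> (s + t) y, where the centre is identified with its coordinates. The
automorphism attached to h by the parameters (s, t) is g |-> g * pairing s t
g h. *)
Definition pairing (s t : 'F_p) (g h : gT) : gT :=
  cen (ex g * ey h * t + ey g * ex h * s)%R (ey g * ey h * (s + t))%R.

Section Gamma.
Variables s t : 'F_p.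

Lemma pairingMl g g' h :
  pairing s t (g * g') h = pairing s t g h * pairing s t g' h.
Proof. by rewrite cenD /pairing !char_cenE; congr cen; ring. Qed.

Lemma pairingMr g h h' :
  pairing s t g (h * h') = pairing s t g h * pairing s t g h'.
Proof. by rewrite cenD /pairing !char_cenE; congr cen; ring. Qed.

Lemma pairing_cenl u v h : pairing s t (cen u v) h = 1.
Proof. by rewrite -cen0 /pairing !char_cenE; congr cen; ring. Qed.

Lemma pairing_cenr u v g : pairing s t g (cen u v) = 1.
Proof. by rewrite -cen0 /pairing !char_cenE; congr cen; ring. Qed.

Lemma pairingC g h k : pairing s t g h * k = k * pairing s t g h.
Proof. exact: cenC. Qed.

Lemma gamma_funM h : {morph (fun g => g * pairing s t g h) : g g' / g * g'}.
Proof.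
move=> g g' /=; rewrite pairingMl -!mulgA; congr (_ * _).
by rewrite !mulgA pairingC.
Qed.

Lemma gamma_fun_inj h : injective (fun g => g * pairing s t g h).
Proof.
apply: (morphfun_inj (gamma_funM h)) => g gz1.
have := congr1 ex gz1; have := congr1 ey gz1.
rewrite !char_cenE (char1 exM) (char1 eyM) !addr0 => ey0 ex0.
by move: gz1; rewrite /pairing ey0 ex0 !mul0r addr0 cen0 mulg1.
Qed.

Definition gamma h : {perm gT} := perm (@gamma_fun_inj h).

Lemma gammaE h g : gamma h g = g * pairing s t g h.
Proof. exact: permE. Qed.

Lemma gammaM : {morph gamma : h k / h * k}.
Proof.
move=> h k; apply/permP => g; rewrite permM !gammaE pairingMr pairingMl.
by rewrite pairing_cenl mulg1 mulgA.
Qed.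

Definition gamma_morphism :=
  Morphism (in2W gammaM : {in [set: gT] &, {morph gamma : h k / h * k}}).

Lemma is_gamma_gamma : is_gamma x y s t gamma_morphism.
Proof.
split.
- apply/subsetP => _ /morphimP[h _ _ ->]; apply/AutTP => g g'.
  by rewrite !gammaE (gamma_funM h).
- rewrite /= !gammaE /pairing ex_x ey_x ex_y ey_y; split.
    by rewrite -[RHS]mulg1 -cen0; congr (_ * cen _ _); ring.
  by rewrite expg_xp cenC; congr (_ * cen _ _); ring.
- rewrite /= gammaE /pairing ex_x ey_x ex_y ey_y expgD expg_xp expg1.
  by congr (_ * cen _ _); ring.
rewrite -[gamma_morphism y]/(gamma y) gammaE /pairing ey_y ex_y.
rewrite expgD expg_yp expg1.
by congr (_ * cen _ _); ring.
Qed.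

(** Both sides are morphisms into the automorphism group, so they agree once
they agree on the generators. *)
Lemma is_gamma_uniq (ga : {morphism [set: gT] >-> {perm gT}}) :
  is_gamma x y s t ga -> forall h, ga h = gamma h.
Proof.
have [_ [gxx gxy] gyx gyy] := is_gamma_gamma.
case=> /subsetP gaA [axx axy] ayx ayy; apply: (eq_morph_gen genG).
- by move=> g h; rewrite morphM ?inE.
- exact: gammaM.
- apply/permP; apply: (eq_morph_gen genG); rewrite ?axx ?axy //.
    by apply/AutTP/gaA; rewrite mem_morphim ?inE.
  by move=> g g'; rewrite !gammaE gamma_funM.
- apply/permP; apply: (eq_morph_gen genG); rewrite ?ayx ?ayy //.
    by apply/AutTP/gaA; rewrite mem_morphim ?inE.
  by move=> g g'; rewrite !gammaE gamma_funM.
Qed.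

(** Morphisms from the group to the operation g, h |-> g * h * pairing s t g
h, which is the operation circle of the parameters (s, t). *)
Definition twisted (f : gT -> gT) :=
  forall g h, f (g * h) = f g * f h * pairing s t (f g) (f h).

Lemma circE (ga : {morphism [set: gT] >-> {perm gT}}) g h :
  is_gamma x y s t ga -> circ ga g h = g * h * pairing s t g h.
Proof.
by move=> gaP; rewrite /circ is_gamma_uniq // gammaE -mulgA pairingC mulgA.
Qed.

(** The right regular representation of the operation circle, as a
permutation of the original group. *)
Definition nu h : {perm gT} := gamma h * actperm 'R h.

Lemma nuE h g : nu h g = g * h * pairing s t g h.
Proof. by rewrite permM gammaE rregE -mulgA pairingC mulgA. Qed.

Lemma nuM h k : nu h * nu k = nu (h * k * pairing s t h k).
Proof.
apply/permP => g; rewrite permM !nuE !pairingMl !pairingMr.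
rewrite pairing_cenl pairing_cenr !mulg1 -!mulgA.
congr (_ * (_ * _)); rewrite (pairingC g h (k * _)) -!mulgA.
by congr (_ * _); rewrite (pairingC g k (_ * _)) -mulgA.
Qed.

Lemma nu1 : nu 1 = 1.
Proof.
by apply/permP => g; rewrite nuE perm1 -cen0 pairing_cenr cen0 !mulg1.
Qed.

Lemma nu_at1 h : nu h 1 = h.
Proof. by rewrite nuE -{2}cen0 pairing_cenl mul1g mulg1. Qed.

Lemma pairingX g h n : pairing s t (g ^+ n) h = pairing s t g h ^+ n.
Proof.
elim: n => [|n IHn]; first by rewrite !expg0 -{1}cen0 pairing_cenl.
by rewrite !expgS pairingMl IHn.
Qed.

Lemma nuX h n : nu h ^+ n = nu (h ^+ n * pairing s t h h ^+ 'C(n, 2)).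
Proof.
elim: n => [|n IHn]; first by rewrite mulg1 nu1.
rewrite expgSr IHn nuM binS bin1 pairingMl !pairingX pairing_cenl expg1n mulg1.
congr nu.
rewrite expgSr expgD -!mulgA; congr (_ * _); rewrite !mulgA; congr (_ * _).
exact/commute_sym/commuteX/commute_sym/pairingC.
Qed.

(** Powers for the operation circle differ from ordinary powers by a multiple
of a binomial coefficient, which p divides when the exponent is p. *)
Lemma nu_expg_p h : nu h ^+ p = nu (h ^+ p).
Proof. by rewrite nuX cenX !mulrn_bin2p cen0 mulg1. Qed.

Lemma nu_expg_pp h : nu h ^+ (p ^ 2) = 1.
Proof. by rewrite -mulnn expgM !nu_expg_p -expgM mulnn expg_pp nu1. Qed.

Lemma nu_cenM h u v : nu h * nu (cen u v) = nu (h * cen u v).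
Proof. by rewrite nuM pairing_cenr mulg1. Qed.

End Gamma.
(** * Twisted endomorphisms *)

Section Twisted.
Variables (s t : 'F_p) (f : gT -> gT).
Hypothesis fT : twisted s t f.

Lemma twisted1 : f 1 = 1.
Proof.
have := fT 1 1; rewrite mulg1 -mulgA -{1}[f 1]mulg1 => /mulgI e1.
have := congr1 ex (esym e1); have := congr1 ey (esym e1).
rewrite /pairing !char_cenE (char1 exM) (char1 eyM) !addr0 => ey0 ex0.
by move: e1; rewrite /pairing ey0 ex0 !mul0r addr0 cen0 mulg1.
Qed.

Lemma twisted_ex g : ex (f g) = (ex (f x) * ex g + ex (f y) * ey g)%R.
Proof.
apply: (@char_basis (ex \o f)) => {}g h.
by rewrite /= fT /pairing !char_cenE addr0.
Qed.

Lemma twisted_ey g : ey (f g) = (ey (f x) * ex g + ey (f y) * ey g)%R.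
Proof.
apply: (@char_basis (ey \o f)) => {}g h.
by rewrite /= fT /pairing !char_cenE addr0.
Qed.

Lemma twistedX g n :
  f (g ^+ n) = f g ^+ n * pairing s t (f g) (f g) ^+ 'C(n, 2).
Proof.
elim: n => [|n IHn]; first by rewrite mulg1 twisted1.
rewrite expgSr fT IHn pairingMl !pairingX pairing_cenl expg1n mulg1 binS bin1.
rewrite expgSr expgD -!mulgA; congr (_ * _); rewrite !mulgA; congr (_ * _).
exact/commute_sym/commuteX/commute_sym/pairingC.
Qed.

Lemma twisted_expg_p g : f (g ^+ p) = f g ^+ p.
Proof. by rewrite twistedX cenX !mulrn_bin2p cen0 mulg1. Qed.

Lemma twisted_cen u v : f (cen u v) =
  cen (ex (f x) * u + ex (f y) * v)%R (ey (f x) * u + ey (f y) * v)%R.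
Proof.
rewrite cen_expg_p twisted_expg_p expg_p twisted_ex twisted_ey.
rewrite exM eyM !(charX exM) !(charX eyM) ex_x ex_y ey_x ey_y.
by rewrite !mul0rn addr0 add0r !natr_Zp.
Qed.

Lemma twisted_mulcen g u v : f (g * cen u v) = f g * f (cen u v).
Proof. by rewrite fT [f (cen u v)]twisted_cen pairing_cenr mulg1. Qed.

(** A map theta acts on the two coordinates, and then on the centre, as the
diagonal matrix (1, d). *)
Lemma twisted_coords n : f x = x -> f y = y ^+ n ->
  [/\ forall g, ex (f g) = ex g,
      forall g, ey (f g) = (n%:R * ey g)%R
    & forall u v, f (cen u v) = cen u (n%:R * v)%R].
Proof.
move=> fx fy; have eX := (charX exM, charX eyM, ex_x, ex_y, ey_x, ey_y).
split=> [g|g|u v]; rewrite 1?twisted_ex 1?twisted_ey 1?twisted_cen fx fy !eX.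
- by ring.
- by ring.
by congr cen; ring.
Qed.

End Twisted.

(** Ordinary endomorphisms are the twisted maps for the zero pairing, so the
lemmas on coordinates apply to them as well. *)
Lemma morph_twisted (f : gT -> gT) :
  {morph f : g h / g * h} <-> twisted 0%R 0%R f.
Proof.
have z0 g h : pairing 0%R 0%R g h = 1.
  by rewrite -cen0 /pairing; congr cen; ring.
by split=> fM g h; rewrite fM z0 mulg1.
Qed.

Lemma eq_twisted s t (f1 f2 : gT -> gT) : twisted s t f1 -> twisted s t f2 ->
  f1 x = f2 x -> f1 y = f2 y -> f1 =1 f2.
Proof.
move=> T1 T2 eqx eqy; apply: ind2 => // g h eg eh.
by rewrite T1 T2 eg eh.
Qed.

Lemma twisted_inj s t (f : gT -> gT) n : twisted s t f ->
  f x = x -> f y = y ^+ n -> n%:R%R != 0%R :> 'F_p -> injective f.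
Proof.
move=> fT fx fy n0 g h efgh.
suff: g * h^-1 = 1 by move/eqP; rewrite -eq_mulgV1 => /eqP.
have: f (g * h^-1) = 1 by rewrite fT efgh -fT mulgV (twisted1 fT).
move: (g * h^-1) => {efgh g h} g fg1.
have [exf eyf fcen] := twisted_coords fT fx fy.
have := congr1 ex fg1; have := congr1 ey fg1.
rewrite exf eyf (char1 exM) (char1 eyM) => /eqP.
rewrite mulf_eq0 (negPf n0) => /eqP ey0 ex0.
have [u [v eg]] := cen_ker ex0 ey0.
move: fg1; rewrite eg fcen => /cen_inj[-> /eqP].
by rewrite mulf_eq0 (negPf n0) => /eqP ->; apply: cen0.
Qed.

(** Modulo the pairing of f2, the composite is twisted by the transport of
the pairing of f1 along f2. As f2 multiplies the coordinate along y by e and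
fixes the one along x, the transport divides s1 and t1 by e. *)
Lemma twisted_comp s1 t1 s2 t2 (f1 f2 : gT -> gT) n (e := n%:R%R : 'F_p) :
    twisted s1 t1 f1 -> twisted s2 t2 f2 ->
    f2 x = x -> f2 y = y ^+ n -> e != 0%R ->
  twisted (s1 / e + s2)%R (t1 / e + t2)%R (f2 \o f1).
Proof.
move=> T1 T2 f2x f2y e0 g h /=.
rewrite T1 (twisted_mulcen T2) T2 -mulgA; congr (_ * _).
have [exf eyf fcen] := twisted_coords T2 f2x f2y.
rewrite /pairing fcen cenD !exf !eyf -/e.
by congr cen; field.
Qed.

Lemma twisted_same s t (f1 f2 : {perm gT}) : twisted s t f1 -> twisted s t f2 ->
  {morph (f1 * f2^-1) : g h / g * h}.
Proof.
move=> T1 T2 g h; apply: (@perm_inj _ f2).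
by rewrite T2 !permM !permKV T1.
Qed.

(** For the operation circle, the commutator of x and y^n is x^(p n (1 + t -
s)), which is x^p when d (1 + t - s) = 1. So the translations nu x and nu y^n
satisfy the relations of the presentation, whence a regular representation
phi by translations of the operation circle; the required map is g |-> phi g
1. *)
Lemma exists_twisted d s t n : n%:R%R = d -> (d * (1 + t - s) = 1)%R ->
  exists th : {perm gT}, [/\ twisted s t th, th x = x & th y = y ^+ n].
Proof.
move=> nd dst.
have n0 : n%:R%R != 0%R :> 'F_p.
  by apply: contra_eq_neq dst; rewrite nd => ->; rewrite mul0r eq_sym oner_neq0.
have [|||phi [phiM phix phiy]] :=
    presents_morph pres (u := nu s t x) (v := nu s t (y ^+ n)).
- exact: nu_expg_pp.
- exact: nu_expg_pp.
- apply: (mulgI (nu s t (y ^+ n) * nu s t x)).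
  rewrite -commgC nu_expg_p expg_p -(mulgA (nu s t (y ^+ n)) (nu s t x)).
  rewrite nu_cenM !nuM; congr (nu _ _ _).
  rewrite pairingMr pairing_cenr mulg1 mulgA [x * y ^+ n]commgC commE -!mulgA.
  congr (_ * (_ * _)); rewrite /pairing !cenD !(charX exM) !(charX eyM).
  rewrite ex_x ex_y ey_x ey_y nd mul0rn; congr cen; last by ring.
  by rewrite -[X in (X + (_ + d * 1 * s))%R]dst; ring.
have phiE g : phi g = nu s t (phi g 1).
  elim/ind2: g => [||g h eg eh]; rewrite ?phix ?phiy ?nu_at1 //.
  by rewrite phiM eg eh nuM nu_at1.
have thT : twisted s t (fun g => phi g 1).
  by move=> g h; rewrite phiM permM {1}[phi h]phiE nuE.
have thx : phi x 1 = x by rewrite phix nu_at1.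
have thy : phi y 1 = y ^+ n by rewrite phiy nu_at1.
exists (perm (twisted_inj thT thx thy n0)); split; rewrite ?permE //.
by move=> g h; rewrite !permE.
Qed.

(** The p-th power map makes an automorphism act on the centre by the same
matrix as on the quotient by the centre. As it preserves the relation [x, y]
= x^p, its matrix maps the line of x to itself, with eigenvalue equal to the
determinant; so the other eigenvalue is 1. *)
Lemma aut_coords (a : {perm gT}) : {morph a : g h / g * h} ->
  exists A B : 'F_p,
  [/\ forall g, ex (a g) = (A * ex g + B * ey g)%R,
      forall g, ey (a g) = ey g
    & forall u v, a (cen u v) = cen (A * u + B * v)%R v].
Proof.
move=> aM; have aT := (morph_twisted a).1 aM.
have: a [~ x, y] = [~ a x, a y].
  by rewrite /commg /conjg !aM !(morphfunV aM).
rewrite xyp cen10 commE (twisted_cen aT) !mulr1 !mulr0 !addr0.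
case/cen_inj2 => eA eC.
have A0 : ex (a x) != 0%R.
  apply: contraNneq xp_neq1 => A0; apply/eqP/(@perm_inj _ a).
  rewrite cen10 (twisted_cen aT) eC A0 !mul0r !mulr0 !addr0 cen0.
  by rewrite (twisted1 aT).
have D1 : ey (a y) = 1%R.
  by apply: (mulfI A0); rewrite mulr1 {2}eA eC mul0r subr0.
exists (ex (a x)), (ex (a y)); split=> [g|g|u v].
- exact: twisted_ex aT g.
- by rewrite (twisted_ey aT) eC D1 mul0r mul1r add0r.
by rewrite (twisted_cen aT) eC D1 mul0r mul1r add0r.
Qed.

(** The entry s + t of the pairing is what makes it invariant under the
unipotent automorphisms y |-> x^b y. *)
Lemma pairing_aut s t (a : {perm gT}) g h : {morph a : g h / g * h} ->
  a (pairing s t g h) = pairing s t (a g) (a h).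
Proof.
case/aut_coords => A [B [exa eya acen]]; rewrite acen /pairing !exa !eya.
by congr cen; ring.
Qed.

(** Let rho^f be the regular group conjugate to the right translations by f;
it consists of the translations nu. It is normalized by the automorphisms,
which preserve the pairing, and by the ordinary translations. Hence Hol is
contained in N(rho^f) = Hol^f, and the two are equal as they have the same
order. *)
Lemma twisted_NHol s t (f : {perm gT}) : twisted s t f -> f \in NHol gT.
Proof.
move=> fT; set rho := actperm 'R @* [set: gT].
have nuN k : nu s t k \in rho :^ f.
  suff ->: nu s t k = actperm 'R (f^-1 k) ^ f.
    by rewrite memJ_conjg mem_morphim ?inE.
  apply/permP => g; rewrite -[g](permKV f) permJ rregE permKV nuE.
  by rewrite fT !permKV.
have Nnu q : q \in rho :^ f -> exists k, q = nu s t k.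
  case/imsetP => _ /morphimP[h _ _ ->] ->; exists (f h).
  by apply/permP => g; rewrite -[g](permKV f) permJ rregE nuE fT !permKV.
(* 'N(rho :^ f) is the conjugate of Hol by f. *)
suff sHN : Hol gT \subset 'N(rho :^ f).
  apply/normP/eqP; rewrite eq_sym eqEcard cardJg leqnn andbT.
  by rewrite /= -normJ.
apply/subsetP => a /Hol_decomp[b bM ->]; apply: groupM; rewrite inE;
  apply/subsetP => _ /imsetP[q /Nnu[h ->] ->].
  suff ->: nu s t h ^ b = nu s t (b h) by [].
  apply/permP => g; rewrite -[g](permKV b) permJ !nuE !bM !permKV.
  by rewrite (pairing_aut _ _ _ _ bM) permKV.
set k := a 1.
(* The conjugate lies in rho^f; its index is the image of 1. *)
suff ->: nu s t h ^ actperm 'R k = nu s t (h ^ k * pairing s t k h^-1) by [].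
apply/permP => g; rewrite -[g](mulgKV k); move: (g * k^-1) => {}g.
rewrite -{1}rregE permJ rregE !nuE pairingMr pairing_cenr mulg1.
have -> : pairing s t (g * k) (h ^ k) = pairing s t g h * pairing s t k h.
  rewrite -pairingMl /pairing conjgE !exM !eyM !(charV exM) !(charV eyM).
  by congr cen; ring.
have zK : pairing s t k h^-1 * (pairing s t g h * pairing s t k h) =
          pairing s t g h.
  by rewrite pairingC -mulgA -pairingMr mulgV -cen0 pairing_cenr mulg1.
by rewrite -!mulgA zK (pairingC _ _ _ _ k) mulKVg.
Qed.
(** * Every element of the multiple holomorph is a twisted map *)

Lemma Fp_opp_fixed (c : 'F_p) : (c = - c -> c = 0)%R.
Proof.
move/eqP; rewrite -subr_eq0 opprK -mulr2n -mulr_natr mulf_eq0.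
by rewrite -(dvdn_pcharf (pchar_Fp p_pr)) gtnNdvd // orbF => /eqP.
Qed.

(** The automorphisms of this lemma and of the next suffice to cut the
equivariant families of automorphisms down to the maps gamma. *)
Lemma exists_aut_inv : exists2 a : {perm gT},
  {morph a : g h / g * h} & a x = x^-1 /\ a y = y.
Proof.
have [|||f [fM fx fy]] := presents_morph pres (u := x^-1) (v := y).
- by rewrite expgVn xpp invg1.
- exact: ypp.
- rewrite commE expg_p !(charV exM) !(charV eyM) ex_x ex_y ey_x ey_y.
  by congr cen; ring.
have fK : cancel f f.
  apply: (eq_morph_gen genG (f1 := f \o f) (f2 := id)) => //=.
  - by move=> g h /=; rewrite !fM.
  - by rewrite fx (morphfunV fM) fx invgK.
  by rewrite !fy.
by exists (perm (can_inj fK)); [move=> g h | split]; rewrite !permE.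
Qed.

Lemma exists_aut_shear : exists2 a : {perm gT},
  {morph a : g h / g * h} & a x = x /\ a y = x * y.
Proof.
have shear u : ey u = 0%R -> exists f : gT -> gT,
    [/\ {morph f : g h / g * h}, f x = x & f y = u * y].
  move=> eu; apply: (presents_morph pres); rewrite ?xpp ?expg_pp //.
  rewrite commE expg_p !eyM ex_x ey_x ey_y eu.
  by congr cen; ring.
have [f [fM fx fy]] := shear x ey_x.
have [|f' [f'M f'x f'y]] := shear x^-1; first by rewrite (charV eyM) ey_x oppr0.
have fK : cancel f f'.
  apply: (eq_morph_gen genG (f1 := f' \o f) (f2 := id)) => //=.
  - by move=> g h /=; rewrite fM f'M.
  - by rewrite fx f'x.
  by rewrite fy f'M f'x f'y mulKVg.
by exists (perm (can_inj fK)); [move=> g h | split]; rewrite !permE.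
Qed.

(** If 1 + t - s = 0, the pairing cancels the commutator and the operation
circle is commutative. *)
Lemma twisted_nonab s t (f : gT -> gT) : injective f -> twisted s t f ->
  (1 + t - s != 0)%R.
Proof.
move=> finj fT; apply/eqP => st0; apply: nonabelian.
apply/eqP/commgP/finj; rewrite !fT [f x * _]commgC commE -!mulgA.
congr (_ * (_ * _)); rewrite /pairing cenD; congr cen; last by ring.
apply/eqP; rewrite -subr_eq0; apply/eqP.
rewrite -[RHS](mulr0 (ex (f x) * ey (f y) - ey (f x) * ex (f y)))%R -st0.
by ring.
Qed.

Section Converse.
(** For f in the multiple holomorph with f 1 = 1, let op be the transport of
the group law along f. Its right translations are conjugates by f of right
translations, hence affine, with linear parts automorphisms ga h. As f
normalizes Hol, a map is affine for one of the two laws exactly when it is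
affine for the other; this makes ga equivariant under automorphisms and an
antihomomorphism. *)
Variable f : {perm gT}.
Hypotheses (Hf : f \in NHol gT) (f1 : f 1 = 1).

Let f1V : f^-1 1 = 1. Proof. by rewrite -{1}f1 permK. Qed.

Let op g h := f (f^-1 g * f^-1 h).
Let ga h g := op g h * h^-1.

Let oE g h : op g h = ga h g * h. Proof. by rewrite /ga mulgKV. Qed.

Let oA g h k : op g (op h k) = op (op g h) k.
Proof. by rewrite /op !permK mulgA. Qed.

Let o1g g : op 1 g = g. Proof. by rewrite /op f1V mul1g permKV. Qed.
Let og1 g : op g 1 = g. Proof. by rewrite /op f1V mulg1 permKV. Qed.

Let ga_aut h : exists2 b : {perm gT},
  {morph b : g k / g * k} & forall g, ga h g = b g.
Proof.
have: actperm 'R (f^-1 h) ^ f \in Hol gT by rewrite memJ_norm ?rreg_Hol.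
have rE g : (actperm 'R (f^-1 h) ^ f) g = op g h.
  by rewrite -{1}[g](permKV f) permJ rregE.
case/Hol_decomp => b bM eb; exists b => // g.
by rewrite /ga -rE eb permM rregE rE o1g mulgK.
Qed.

Let gaM h : {morph (ga h) : g k / g * k}.
Proof. by have [b bM gaE] := ga_aut h; move=> g k; rewrite !gaE bM. Qed.

Let ga_o h k g : ga (op h k) g = ga k (ga h g).
Proof.
apply: (mulIg (op h k)); rewrite -oE oA oE [op g h]oE gaM -mulgA.
by rewrite [op h k]oE.
Qed.

Let ga1 g : ga 1 g = g. Proof. by rewrite /ga og1 invg1 mulg1. Qed.

Let ga_equiv (a : {perm gT}) : {morph a : g h / g * h} ->
  forall g h, ga (a h) (a g) = a (ga h g).
Proof.
move=> aM; have: a ^ f^-1 \in Hol gT by rewrite memJ_norm ?groupV ?morph_Hol.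
have cE g : (a ^ f^-1) g = f^-1 (a (f g)).
  by rewrite conjgE invgK !permM.
move=> /Hol_fix1; rewrite cE f1 (morphfun1 aM) f1V => /(_ erefl) cM g h.
suff oM g' h' : a (op g' h') = op (a g') (a h').
  by rewrite /ga -oM aM (morphfunV aM).
have := cM (f^-1 g') (f^-1 h'); rewrite !cE !permKV /op => <-.
by rewrite permKV.
Qed.

(** The ordinary translation by k is affine for op. Comparing the two ways to
translate op g h by k on the right gives ga h = ga (op j (h * k)), where j is
the inverse of k for op. *)
Let ga_anti h k g : ga (h * k) g = ga h (ga k g).
Proof.
have eM : actperm 'R k ^ f^-1 \in Hol gT.
  by rewrite memJ_norm ?groupV ?rreg_Hol.
have eE g' : (actperm 'R k ^ f^-1) g' = f^-1 (f g' * k).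
  by rewrite conjgE invgK !permM rregE.
pose j := f (f^-1 k)^-1; pose m := op j (h * k).
have okj : op k j = 1 by rewrite /op /j permK mulgV f1.
have oR g' : op g' h * k = op (g' * k) m.
  have := (HolP _ eM) (f^-1 g') (f^-1 h).
  rewrite !eE !permKV f1 mul1g -/(op g' h) => /(congr1 f); rewrite permKV => ->.
  by rewrite /op /m /op /j !permK !mulgA.
have ga_m g' : ga h g' = ga m g'.
  apply: (mulIg (h * k)); rewrite mulgA -oE oR oE gaM -mulgA; congr (_ * _).
  by rewrite -oE -[k]mul1g -oR o1g mul1g.
by rewrite ga_m /m ga_o -(ga_o k j) okj ga1.
Qed.

Let ga_ex h g : ex (ga h g) = (ex (ga h x) * ex g + ex (ga h y) * ey g)%R.
Proof. exact: twisted_ex ((morph_twisted _).1 (gaM h)) g. Qed.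

Let ga_ey h g : ey (ga h g) = ey g.
Proof.
have [b bM gaE] := ga_aut h; rewrite gaE.
by have [? [? [_ ->]]] := aut_coords bM.
Qed.

(** As ga is an antihomomorphism, h |-> ex (ga h x) is a multiplicative
character of a group of exponent p^2 with values in F_p^*, hence trivial. *)
Let ga_x h : ex (ga h x) = 1%R.
Proof.
have AM k l : ex (ga (k * l) x) = (ex (ga k x) * ex (ga l x))%R.
  by rewrite ga_anti ga_ex ga_ey ey_x mulr0 addr0.
have AX k n : ex (ga (k ^+ n) x) = (ex (ga k x) ^+ n)%R.
  elim: n => [|n IHn]; first by rewrite ga1 ex_x.
  by rewrite expgS AM IHn exprS.
have card_pow (a : 'F_p) : (a ^+ p = a)%R.
  by have := expf_card a; rewrite card_Fp.
by have := AX h (p ^ 2)%N; rewrite expg_pp ga1 ex_x -mulnn exprM !card_pow.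
Qed.

(** Once ga h fixes ex x, the map h |-> ex (ga h y) is additive. Equivariance
under the two automorphisms, applied to h = y, makes it vanish at y and then
at x. *)
Let ga_y h : ex (ga h y) = 0%R.
Proof.
have BM k l : ex (ga (k * l) y) = (ex (ga k y) + ex (ga l y))%R.
  by rewrite ga_anti ga_ex ga_ey ga_x ey_y; ring.
have [a aM [ax ay]] := exists_aut_inv.
have [b bM [bx by_]] := exists_aut_shear.
have aT := (morph_twisted a).1 aM; have bT := (morph_twisted b).1 bM.
have By : ex (ga y y) = 0%R.
  have := congr1 ex (ga_equiv aM y y).
  rewrite ay (twisted_ex aT) ax ay (charV exM) ex_x ex_y mul0r addr0 mulN1r.
  exact: Fp_opp_fixed.
have Bx : ex (ga x y) = 0%R.
  have := congr1 ex (ga_equiv bM y y).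
  rewrite by_ gaM exM (twisted_ex bT) bx by_ exM !BM ga_x By ga_ey.
  rewrite ex_x ex_y ey_y !mulr1 !addr0 mulr0 add0r => /eqP.
  by rewrite -subr_eq0 addrC addKr => /eqP.
by rewrite (char_basis (e := fun h => ex (ga h y))) // Bx By; ring.
Qed.

(** By the coordinates of ga h, the quotient w g h of ga h g by g is central
and bilinear, hence given by eight coefficients in F_p. Equivariance under
inversion of x kills the four entries of the wrong parity, among them that of
(x, x) along x; equivariance under y |-> x y kills the entry of (x, x) along
y and makes that of (y, y) the sum of those of (x, y) and (y, x). What
remains is a pairing. *)
Lemma NHol_twisted : exists s t, twisted s t f.
Proof.
have ga_cen h u v : ga h (cen u v) = cen u v.
  rewrite (twisted_cen ((morph_twisted _).1 (gaM h))).
  rewrite ga_x ga_y !ga_ey ey_x ey_y.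
  by congr cen; ring.
pose w g h := g^-1 * ga h g.
have wE g h : ga h g = g * w g h by rewrite mulKVg.
have wP (gh : gT * gT) : exists uv : 'F_p * 'F_p, w gh.1 gh.2 = cen uv.1 uv.2.
  have [||u [v ->]] := @cen_ker (w gh.1 gh.2); last by exists (u, v).
    by rewrite exM (charV exM) ga_ex ga_x ga_y; ring.
  by rewrite eyM (charV eyM) ga_ey addNr.
have {wP} [W WE] := fin_all_exists wP.
pose W1 g h := (W (g, h)).1; pose W2 g h := (W (g, h)).2.
have {}WE g h : w g h = cen (W1 g h) (W2 g h) by rewrite -(WE (g, h)).
have wMl g g' h : w (g * g') h = w g h * w g' h.
  apply: (mulgI (g * g')); rewrite -wE gaM !wE WE -!mulgA; congr (_ * _).
  by rewrite mulgA cenC -mulgA.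
have wMr g h h' : w g (h * h') = w g h * w g h'.
  apply: (mulgI g); rewrite -wE ga_anti [ga h' g]wE gaM [ga h g]wE -mulgA.
  by rewrite [w g h']WE ga_cen.
have WMl g g' h : W1 (g * g') h = (W1 g h + W1 g' h)%R /\
                  W2 (g * g') h = (W2 g h + W2 g' h)%R.
  by have := wMl g g' h; rewrite !WE cenD => /cen_inj2.
have WMr g h h' : W1 g (h * h') = (W1 g h + W1 g h')%R /\
                  W2 g (h * h') = (W2 g h + W2 g h')%R.
  by have := wMr g h h'; rewrite !WE cenD => /cen_inj2.
have bilin (U : gT -> gT -> 'F_p) :
    (forall g g' h, U (g * g') h = (U g h + U g' h)%R) ->
    (forall g h h', U g (h * h') = (U g h + U g h')%R) ->
    forall g h, U g h = (U x x * (ex g * ex h) + U x y * (ex g * ey h)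
                   + U y x * (ey g * ex h) + U y y * (ey g * ey h))%R.
  move=> Ul Ur g h.
  rewrite (char_basis (e := U^~ h)) // (char_basis (e := U x)) //.
  by rewrite (char_basis (e := U y)) //; ring.
have W1E :=
  bilin W1 (fun g g' h => (WMl g g' h).1) (fun g h h' => (WMr g h h').1).
have W2E :=
  bilin W2 (fun g g' h => (WMl g g' h).2) (fun g h h' => (WMr g h h').2).
have w_equiv (a : {perm gT}) g h : {morph a : g h / g * h} ->
    w (a g) (a h) = a (w g h).
  by move=> aM; rewrite /w ga_equiv // -(morphfunV aM) -aM.
have [a aM [ax ay]] := exists_aut_inv.
have [b bM [bx by_]] := exists_aut_shear.
have aT := (morph_twisted a).1 aM; have bT := (morph_twisted b).1 bM.
have Wa g h : W1 (a g) (a h) = (- W1 g h)%R /\ W2 (a g) (a h) = W2 g h.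
  have := w_equiv a g h aM; rewrite !WE (twisted_cen aT) => /cen_inj2[-> ->].
  rewrite ax ay (charV exM) (charV eyM) ex_x ex_y ey_x ey_y.
  by split; ring.
have Wb g h : W1 (b g) (b h) = (W1 g h + W2 g h)%R /\ W2 (b g) (b h) = W2 g h.
  have := w_equiv b g h bM; rewrite !WE (twisted_cen bT) => /cen_inj2[-> ->].
  rewrite bx by_ exM eyM ex_x ex_y ey_x ey_y.
  by split; ring.
exists (W1 y x), (W1 x y).
(* These entries equal their opposites, by equivariance under inversion. *)
have W1xx : W1 x x = 0%R.
  apply: Fp_opp_fixed; rewrite -(Wa x x).1 ax.
  by rewrite [RHS]W1E !(charV exM) !(charV eyM) ex_x ey_x; ring.
have W1yy : W1 y y = 0%R by apply: Fp_opp_fixed; rewrite -(Wa y y).1 ay.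
have W2xy : W2 x y = 0%R.
  apply: Fp_opp_fixed; rewrite -{1}(Wa x y).2 ax ay.
  by rewrite [LHS]W2E !(charV exM) !(charV eyM) ex_x ey_x ex_y ey_y; ring.
have W2yx : W2 y x = 0%R.
  apply: Fp_opp_fixed; rewrite -{1}(Wa y x).2 ax ay.
  by rewrite [LHS]W2E !(charV exM) !(charV eyM) ex_x ey_x ex_y ey_y; ring.
(* From the shear, in the entries (x, y) and then (y, y). *)
have W2xx : W2 x x = 0%R.
  by have := (Wb x y).2; rewrite bx by_ (WMr _ _ _).2 W2xy addr0.
have W2yy : W2 y y = (W1 y x + W1 x y)%R.
  have := (Wb y y).1; rewrite by_ (WMl _ _ _).1 !(WMr _ _ _).1 W1xx W1yy.
  by rewrite !add0r addr0 => <-; rewrite addrC.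
move=> u v; have -> : f (u * v) = op (f u) (f v) by rewrite /op !permK.
rewrite oE wE WE -mulgA cenC mulgA; congr (_ * _); rewrite W1E W2E /pairing.
by rewrite W1xx W1yy W2xy W2yx W2xx W2yy; congr cen; ring.
Qed.

End Converse.

(** * The classes of the maps theta *)

Lemma is_theta_repP n d s (th : {perm gT}) : is_theta_rep x y n d s th <->
  [/\ n%:R%R = d, twisted s (d^-1 + s - 1)%R th, th x = x & th y = y ^+ n].
Proof.
split=> [[ga gaP [nd thM thx thy]] | [nd thT thx thy]].
  by split=> // g h; rewrite thM (circE _ _ gaP).
exists (gamma_morphism s (d^-1 + s - 1)%R); first exact: is_gamma_gamma.
by split=> // g h; rewrite (circE _ _ (is_gamma_gamma _ _)) thT.
Qed.

Lemma is_theta_twisted d s (th : {perm gT}) :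
  is_theta x y d s th -> twisted s (d^-1 + s - 1)%R th.
Proof. by case=> n /is_theta_repP[]. Qed.

Lemma exists_unique_theta n (d s : 'F_p) : d != 0%R -> n%:R%R = d ->
  exists! th : {perm gT}, is_theta_rep x y n d s th.
Proof.
move=> d0 nd.
have [|th [thT thx thy]] := @exists_twisted d s (d^-1 + s - 1)%R n nd.
  by field.
exists th; split=> [|th' /is_theta_repP[_ thT' thx' thy']].
  exact/is_theta_repP.
by apply/permP; apply: (eq_twisted thT thT'); rewrite ?thx' ?thy'.
Qed.

Lemma twisted_coset s t (f1 f2 : {perm gT}) :
    twisted s t f1 -> twisted s t f2 ->
  coset (Hol gT) f1 = coset (Hol gT) f2.
Proof.
move=> T1 T2; rewrite -[f1](mulgKV f2) coset_kerl //.
exact/morph_Hol/(twisted_same T1 T2).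
Qed.

(** Equal classes give f1 = a f2 with a an automorphism, so that the
surjective map f1 is twisted by both pairings; hence the pairings coincide.
*)
Lemma twisted_coset_inj s t s' t' (f1 f2 : {perm gT}) :
    twisted s t f1 -> twisted s' t' f2 ->
  coset (Hol gT) f1 = coset (Hol gT) f2 -> s = s' /\ t = t'.
Proof.
move=> T1 T2 /rcoset_kercosetP e12.
have: f1 * f2^-1 \in Hol gT.
  by rewrite -mem_rcoset; apply: e12; apply: twisted_NHol; eassumption.
have f2V1 : f2^-1 1 = 1 by rewrite -{1}(twisted1 T2) permK.
move/Hol_fix1; rewrite permM (twisted1 T1) f2V1 => /(_ erefl) aM.
have zz g h : pairing s t (f1 g) (f1 h) = pairing s' t' (f1 g) (f1 h).
  apply: (mulgI (f1 g * f1 h)); rewrite -T1.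
  have := T2 (f2^-1 (f1 g)) (f2^-1 (f1 h)); rewrite !permKV => <-.
  have := aM g h; rewrite !permM => <-.
  by rewrite permKV.
have {}zz g h : pairing s t g h = pairing s' t' g h.
  by have := zz (f1^-1 g) (f1^-1 h); rewrite !permKV.
have [es _] := cen_inj2 (zz y x); have [et _] := cen_inj2 (zz x y).
move: es et; rewrite ex_x ex_y ey_x ey_y.
by rewrite !(mul1r, mul0r, mulr0, add0r, addr0).
Qed.

Section Family.
Variable theta : 'F_p -> 'F_p -> {perm gT}.
Hypothesis thetaP : forall d s : 'F_p, d != 0%R -> is_theta x y d s (theta d s).
Local Notation cth d s := (coset (Hol gT) (theta d s)).

Let thT (d s : 'F_p) : d != 0%R -> twisted s (d^-1 + s - 1)%R (theta d s).
Proof. by move=> d0; apply/is_theta_twisted/thetaP. Qed.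

Let thN (d s : 'F_p) : d != 0%R -> theta d s \in NHol gT.
Proof. by move=> d0; apply: twisted_NHol (thT s d0). Qed.

Lemma cosetM_theta (d e s u : 'F_p) : d != 0%R -> e != 0%R ->
  cth d s * cth e u = cth (d * e)%R (s * e^-1 + u)%R.
Proof.
move=> d0 e0; rewrite -morphM ?thN //.
have [n /is_theta_repP[ne Te ex_ ey_]] := thetaP u e0.
have ne0 : n%:R%R != 0%R :> 'F_p by rewrite ne.
have := twisted_comp (thT s d0) Te ex_ ey_ ne0; rewrite ne => T12.
have T3 := thT (s * e^-1 + u)%R (mulf_neq0 d0 e0).
have Et : ((d * e)^-1 + (s * e^-1 + u) - 1 =
          (d^-1 + s - 1) / e + (e^-1 + u - 1) :> 'F_p)%R.
  by field; rewrite e0 d0.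
rewrite Et in T3; apply: twisted_coset T3 => g h.
by have := T12 g h; rewrite /= !permM.
Qed.

Lemma coset_theta_inj (d e s u : 'F_p) : d != 0%R -> e != 0%R ->
  cth d s = cth e u -> d = e /\ s = u.
Proof.
move=> d0 e0 /(twisted_coset_inj (thT s d0) (thT u e0))[es].
by rewrite es => /addIr /addIr /invr_inj.
Qed.

(** An element of NHol can be corrected by a translation so as to fix 1. It
is then twisted for some (s, t) with 1 + t - s invertible, and its class
depends only on (s, t); the map theta with d = 1 / (1 + t - s) has the same
parameters. *)
Lemma T_theta : T gT =
  [set cth d s | d in [set a : 'F_p | a != 0%R], s in [set: 'F_p]]
  :> {set coset_of (Hol gT)}.
Proof.
apply/setP => q; apply/idP/imset2P => [|[d s]]; last first.
  by rewrite inE => d0 _ ->; rewrite mem_quotient ?thN.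
case/morphimP => f _ Nf ->.
pose f0 := f * (actperm 'R (f 1))^-1.
have Nf0 : f0 \in NHol gT.
  by rewrite groupM ?groupV // (subsetP (Hol_sub_NHol gT)) ?rreg_Hol.
have f01 : f0 1 = 1.
  by apply: (@perm_inj _ (actperm 'R (f 1))); rewrite permM permKV rregE mul1g.
have [s [t fT]] := NHol_twisted Nf0 f01.
have d0 := twisted_nonab (@perm_inj _ f0) fT.
exists (1 + t - s)^-1%R s; rewrite ?inE ?invr_eq0 //=.
rewrite -(coset_kerr f (groupVr (rreg_Hol (f 1)))) -/f0.
apply: twisted_coset fT _.
have := thT s (negbT (etrans (invr_eq0 _) (negbTE d0))).
by rewrite invrK; congr twisted; ring.
Qed.

Lemma card_T : #|T gT| = (p * (p - 1))%N.
Proof.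
rewrite T_theta curry_imset2X card_in_imset => [|[d s] [e u]].
  rewrite cardsX cardsT card_Fp // mulnC; congr (_ * _)%N.
  have -> : [set a : 'F_p | a != 0%R] = [set~ 0%R].
    by apply/setP => a; rewrite !inE.
  by rewrite cardsC1 card_Fp // subn1.
rewrite !inE /= !andbT => d0 e0 /(coset_theta_inj d0 e0)[-> ->].
by [].
Qed.

(** The class of theta d s corresponds to a |-> a / d + s: under products
from left to right these affine maps compose as the classes do. *)
Lemma T_isog_AGL1 : T gT \isog AGL1 p.
Proof.
rewrite isog_sym.
pose m (f : {perm 'F_p}) := cth (f 1%R - f 0%R)^-1%R (f 0%R).
have AP f : f \in AGL1 p ->
    exists2 d : 'F_p, d != 0%R & forall a, f a = (d * a + f 0%R)%R.
  rewrite inE => /existsP[d /existsP[s /andP[d0 /forallP fE]]].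
  by exists d => // a; rewrite !(eqP (fE _)) mulr0 add0r.
have mE (f : {perm 'F_p}) (d : 'F_p) :
    (forall a, f a = (d * a + f 0%R)%R) -> m f = cth d^-1%R (f 0%R).
  by move=> fE; rewrite /m [f 1%R]fE mulr1 addrK.
have mM : {in AGL1 p &, {morph m : f g / f * g}}.
  move=> f g /AP[d d0 fE] /AP[e e0 gE].
  rewrite (mE _ _ fE) (mE _ _ gE) cosetM_theta ?invr_eq0 // invrK.
  rewrite (mE _ (d * e)%R) => [|a]; rewrite !permM.
    by rewrite invfM [g (f _)]gE [(f _ * e)%R]mulrC.
  by rewrite gE [g (f 0%R)]gE [f a]fE; ring.
apply/isogP; exists (Morphism mM).
  apply/injmP => f g /AP[d d0 fE] /AP[e e0 gE] /=.
  rewrite (mE _ _ fE) (mE _ _ gE).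
  case/coset_theta_inj; rewrite ?invr_eq0 // => /invr_inj de fg0.
  by apply/permP => a; rewrite fE gE de fg0.
apply/setP => q; rewrite T_theta; apply/morphimP/imset2P.
  case=> f /AP[d d0 fE] _ -> /=; rewrite (mE _ _ fE).
  by exists d^-1%R (f 0%R); rewrite ?inE ?invr_eq0.
case=> d s; rewrite inE => d0 _ ->.
have affI : injective (fun a : 'F_p => d^-1 * a + s)%R.
  by move=> a b /addIr /mulfI; apply; rewrite invr_eq0.
have affA : perm affI \in AGL1 p.
  rewrite inE; apply/existsP; exists d^-1%R; apply/existsP; exists s.
  by rewrite invr_eq0 d0; apply/forallP => a; rewrite permE.
exists (perm affI) => //=.
by rewrite (mE _ d^-1%R) ?invrK => [|a]; rewrite !permE mulr0 add0r.
Qed.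
End Family.
End Structure.

(** * The holomorph of a group of prime order *)

Section PrimeOrder.
Variables (p : nat) (hT : finGroupType).
Hypotheses (p_pr : prime p) (oh : #|[set: hT]| = p).

(** Additive maps of F_p are linear, so the affine maps in the sense of the
group law are those of the form a |-> d a + s. *)
Lemma AGL1P (f : {perm 'F_p}) :
  reflect (forall a b, f (a + b) = f a - f 0 + f b)%R (f \in AGL1 p).
Proof.
rewrite inE; apply: (iffP existsP) => [[d /existsP[s]] | fE].
  case/andP=> _ /forallP fE a b; rewrite !(eqP (fE _)); ring.
pose d := (f 1 - f 0)%R.
have fnat n : (f n%:R = d * n%:R + f 0)%R.
  elim: n => [|n IHn]; first by rewrite mulr0 add0r.
  by rewrite mulrSr fE IHn /d; ring.
exists d; apply/existsP; exists (f 0%R); apply/andP; split.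
  by rewrite subr_eq0 (inj_eq perm_inj) oner_eq0.
by apply/forallP => a; rewrite -[a]natr_Zp fnat.
Qed.

Lemma AGL1_isog_Hol : AGL1 p \isog Hol hT.
Proof.
have [c defH] : exists c, [set: hT] = <[c]>.
  by apply/cyclicP/prime_cyclic; rewrite oh.
have oc : #[c] = p by rewrite orderE -defH.
have cp : c ^+ p = 1 by rewrite -oc expg_order.
have c1 : c != 1 by rewrite -order_eq1 oc neq_ltn (prime_gt1 p_pr) orbT.
pose phi (a : 'F_p) := c ^+ a.
have phiD a b : phi (a + b)%R = phi a * phi b by apply: expg_FpD.
have phi0 : phi 0%R = 1 by [].
have phiB a b : phi (a - b)%R = phi a * (phi b)^-1.
  by apply: (mulIg (phi b)); rewrite -phiD subrK mulgKV.
have phi_inj : injective phi.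
  move=> a b eab; apply/eqP; rewrite -subr_eq0; apply/eqP.
  by apply: (expg_Fp_inj p_pr cp c1); rewrite -/(phi _) phiB eab mulgV.
have [psi phiK psiK] : bijective phi.
  by apply: inj_card_bij => //; rewrite card_Fp // -oh cardsT.
have psiM g h : psi (g * h) = (psi g + psi h)%R.
  by rewrite -{1}[g]psiK -{1}[h]psiK -phiD phiK.
have conj_inj (f : {perm 'F_p}) : injective (phi \o f \o psi).
  by apply/inj_comp/(can_inj psiK)/inj_comp => //; apply: perm_inj.
have conjV_inj (f : {perm hT}) : injective (psi \o f \o phi).
  by apply/inj_comp => //; apply/inj_comp/perm_inj/(can_inj psiK).
pose m f := perm (conj_inj f).
have mM : {in AGL1 p &, {morph m : f g / f * g}}.
  by move=> f g _ _; apply/permP => h; rewrite permM !permE /= permM phiK.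
apply/isogP; exists (Morphism mM).
  apply/injmP => f g _ _ /permP efg; apply/permP => a; apply: phi_inj.
  by have := efg (phi a); rewrite !permE /= phiK.
have psi1 : psi 1 = 0%R by rewrite -phi0 phiK.
apply/setP => q; apply/morphimP/HolP => [[f _ /AGL1P fE ->] g h | qE].
  by rewrite !permE /= psiM fE phiD phiB psi1.
have affA : perm (conjV_inj q) \in AGL1 p.
  apply/AGL1P => a b; rewrite !permE /= phiD qE !psiM phi0; congr (_ + _ + _)%R.
  by apply: phi_inj; rewrite psiK -[(- _)%R]add0r phiB psiK mul1g.
exists (perm (conjV_inj q)) => //.
by apply/permP => h; rewrite !permE /= permE /= !psiK.
Qed.

End PrimeOrder.

Theorem theorem4p3 (p : nat) (gT : finGroupType) (x y : gT) :
  prime p -> (2 < p)%N -> presents p x y ->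
  (* theta_{d,s} exists, for every representative n of d *)
  (forall (n : nat) (d s : 'F_p), d != 0%R -> n%:R%R = d ->
     exists! th : {perm gT}, is_theta_rep x y n d s th)
  /\
  (* its class in T(G) does not depend on the representative *)
  (forall (d s : 'F_p) (th1 th2 : {perm gT}), d != 0%R ->
     is_theta x y d s th1 -> is_theta x y d s th2 ->
     [/\ th1 \in NHol gT, th2 \in NHol gT
       & coset (Hol gT) th1 = coset (Hol gT) th2])
  /\
  (forall theta : 'F_p -> 'F_p -> {perm gT},
     (forall d s : 'F_p, d != 0%R -> is_theta x y d s (theta d s)) ->
     [/\ forall d e s u : 'F_p, d != 0%R -> e != 0%R ->
           coset (Hol gT) (theta d s) * coset (Hol gT) (theta e u)
           = coset (Hol gT) (theta (d * e)%R (s * e^-1 + u)%R),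
         T gT = [set coset (Hol gT) (theta d s) | d in [set a : 'F_p | a != 0%R], s in [set: 'F_p]]
           :> {set coset_of (Hol gT)},
         #|T gT| = (p * (p - 1))%N,
         T gT \isog AGL1 p
       & forall hT : finGroupType, #|[set: hT]| = p -> T gT \isog Hol hT]).
Proof.
move=> p_pr p_gt2 pres.
have [ex [exM ex_x ex_y]] := exists_char p_pr pres 1%R 0%R.
have [ey [eyM ey_x ey_y]] := exists_char p_pr pres 0%R 1%R.
split=> [n d s|]; first exact: (exists_unique_theta p_pr p_gt2 pres exM eyM).
split=> [d s th1 th2 _ th1P th2P | theta thetaP].
  have tw := is_theta_twisted p_pr pres exM eyM ex_x ex_y ey_x ey_y.
  have inN := twisted_NHol p_pr p_gt2 pres exM eyM ex_x ex_y ey_x ey_y.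
  by split; [apply: inN (tw _ _ _ th1P) | apply: inN (tw _ _ _ th2P)
            | apply: twisted_coset (tw _ _ _ th1P) (tw _ _ _ th2P)].
have isoAGL1 : T gT \isog AGL1 p.
  exact: (T_isog_AGL1 p_pr p_gt2 pres exM eyM ex_x ex_y ey_x ey_y thetaP).
split=> // [d e s u|||hT oh].
- exact: (cosetM_theta p_pr p_gt2 pres exM eyM ex_x ex_y ey_x ey_y thetaP).
- exact: (T_theta p_pr p_gt2 pres exM eyM ex_x ex_y ey_x ey_y thetaP).
- exact: (card_T p_pr p_gt2 pres exM eyM ex_x ex_y ey_x ey_y thetaP).
exact: isog_trans isoAGL1 (AGL1_isog_Hol p_pr oh).
Qed.
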